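(* Let $a,b,t$ be complex numbers, let $f_3(z,a,b)$ be the unique formal power series with $f_3=1+azf_3+bz^3f_3^2$, define $C(n,3,a,b,t)$ by $\sum_{n\ge0}C(n,3,a,b,t)z^n=\frac{f_3}{1-tzf_3}$, and let $D_2^{(3)}(N,a,b,t)=\det\big(C(i+j+2,3,a,b,t)\big)_{i,j=0}^{N-1}$. Then $$D_2^{(3)}(3n,a,b,t)=(-1)^{n+1}b^{3n^2+n-1}\Big(a^3\sum_{i=0}^ni^2-(n+1)b+nat\big(t+(n+1)a\big)\Big)\quad(n\ge0),$$ $$D_2^{(3)}(3n+1,a,b,t)=(-1)^n\big(t+(n+1)a\big)^2b^{3n^2+3n}\quad(n\ge0),$$ $$D_2^{(3)}(3n-1,a,b,t)=(-1)^{n-1}b^{3n^2-n-1}\Big(a^3\sum_{i=0}^ni^2-nb+nat\big(t+(n+1)a\big)\Big)\quad(n\ge1).$$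
   Context: The determinant of a $0\times0$ matrix is $1$. *)

(* Defs.v *)
From HB Require Import structures.
From mathcomp Require Import all_boot all_order all_algebra.
From mathcomp Require Import boolp reals.
From mathcomp Require Import complex.

Set Implicit Arguments.
Unset Strict Implicit.
Unset Printing Implicit Defensive.

Import GRing.Theory.
Local Open Scope ring_scope.

(* [Fps u] is the formal power series [\sum_n u n z^n], and [f n] is the
   coefficient of [z^n] in [f]. *)
Record fps (R : Type) := Fps { fps_coef :> nat -> R }.

Lemma fpsP (R : Type) (f g : fps R) : (forall n, f n = g n) -> f = g.
Proof. by case: f g => [u] [v] /= uv; congr Fps; apply: funext. Qed.

HB.instance Definition _ (R : Type) := gen_eqMixin (fps R).
HB.instance Definition _ (R : Type) := gen_choiceMixin (fps R).

Section FpsZmod.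
Variable R : zmodType.
Implicit Types f g h : fps R.

Definition fps_zero : fps R := Fps (fun=> 0).
Definition fps_opp f : fps R := Fps (fun n => - f n).
Definition fps_add f g : fps R := Fps (fun n => f n + g n).

Lemma fps_addA : associative fps_add.
Proof. by move=> f g h; apply: fpsP => n /=; rewrite addrA. Qed.
Lemma fps_addC : commutative fps_add.
Proof. by move=> f g; apply: fpsP => n /=; rewrite addrC. Qed.
Lemma fps_add0 : left_id fps_zero fps_add.
Proof. by move=> f; apply: fpsP => n /=; rewrite add0r. Qed.
Lemma fps_addN : left_inverse fps_zero fps_opp fps_add.
Proof. by move=> f; apply: fpsP => n /=; rewrite addNr. Qed.

HB.instance Definition _ :=
  GRing.isZmodule.Build (fps R) fps_addA fps_addC fps_add0 fps_addN.

End FpsZmod.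

Section FpsRing.
Variable R : comNzRingType.
Implicit Types f g h : fps R.

Definition fpsC (c : R) : fps R := Fps (fun n => if n == 0%N then c else 0).
Definition fpsX : fps R := Fps (fun n => (n == 1%N)%:R).
Definition fps_mul f g : fps R :=
  Fps (fun n => \sum_(k < n.+1) f k * g (n - k)%N).

Definition fps_trunc n f : {poly R} := \poly_(i < n) f i.

Lemma coef_fps_trunc n f i : (i < n)%N -> (fps_trunc n f)`_i = f i.
Proof. by rewrite coef_poly => ->. Qed.

Lemma fps_mul_trunc m n f g : (n < m)%N ->
  fps_mul f g n = (fps_trunc m f * fps_trunc m g)`_n.
Proof.
move=> nm; rewrite coefM /=; apply: eq_bigr => k _.
rewrite !coef_fps_trunc //; first exact: leq_ltn_trans (leq_subr _ _) nm.
by apply: leq_trans nm; exact: ltn_ord.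
Qed.

Lemma fps_mulC : commutative fps_mul.
Proof.
by move=> f g; apply: fpsP => n; rewrite !(fps_mul_trunc _ _ (ltnSn n)) mulrC.
Qed.

Lemma fps_mulA : associative fps_mul.
Proof.
move=> f g h; apply: fpsP => n.
transitivity ((fps_trunc n.+1 f * fps_trunc n.+1 g * fps_trunc n.+1 h)`_n).
  rewrite -mulrA coefM; apply: eq_bigr => k _.
  rewrite coef_fps_trunc // (@fps_mul_trunc n.+1) //.
  by rewrite ltnS leq_subr.
rewrite coefM; apply: eq_bigr => k _.
rewrite (@fps_mul_trunc n.+1) // coef_fps_trunc //.
by rewrite ltnS leq_subr.
Qed.

Lemma fps_mul1 : left_id (fpsC 1) fps_mul.
Proof.
move=> f; apply: fpsP => n /=.
rewrite big_ord_recl /= mul1r subn0 big1 ?addr0 // => i _.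
by rewrite mul0r.
Qed.

Lemma fps_mulDl : left_distributive fps_mul +%R.
Proof.
move=> f g h; apply: fpsP => n /=; rewrite -big_split /=.
by apply: eq_bigr => k _; rewrite mulrDl.
Qed.

Lemma fps1_neq0 : fpsC 1 != 0.
Proof.
apply/eqP => /(congr1 (fun f : fps R => f 0%N)) /= /eqP.
by rewrite oner_eq0.
Qed.

HB.instance Definition _ := GRing.Zmodule_isComNzRing.Build (fps R)
  fps_mulA fps_mulC fps_mul1 fps_mulDl fps1_neq0.

End FpsRing.

Arguments fpsX {R}.

Section FpsUnit.
Variable R : comUnitRingType.
Implicit Types f g : fps R.

(* The first [n] coefficients of [f^-1], by the usual recursion
   [g_m = f_0^-1 ([m = 0] - \sum_(i < m) f_(m-i) g_i)]. *)
Fixpoint fps_inv_prefix f n : seq R :=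
  if n is m.+1 then
    let s := fps_inv_prefix f m in
    rcons s ((f 0%N)^-1 * ((m == 0%N)%:R - \sum_(i < m) f (m - i)%N * s`_i))
  else [::].

Definition fps_unit : pred (fps R) := fun f => f 0%N \is a GRing.unit.

Definition fps_inv f : fps R :=
  if fps_unit f then Fps (fun n => (fps_inv_prefix f n.+1)`_n) else f.

Lemma size_fps_inv_prefix f n : size (fps_inv_prefix f n) = n.
Proof. by elim: n => //= n IH; rewrite size_rcons IH. Qed.

Lemma fps_inv_prefixE f n i : (i < n)%N ->
  (fps_inv_prefix f n)`_i = (fps_inv_prefix f i.+1)`_i.
Proof.
elim: n => // n IH; rewrite ltnS leq_eqVlt => /predU1P [-> //|lt_in].
by rewrite -IH //= nth_rcons size_fps_inv_prefix lt_in.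
Qed.

Lemma fps_mulV : {in fps_unit, left_inverse 1 fps_inv *%R}.
Proof.
move=> f; rewrite unfold_in => Uf; apply: fpsP => n.
rewrite /fps_inv /fps_unit ifT // -[LHS]/(\sum_(k < n.+1) _) big_ord_recr /= subnn.
rewrite nth_rcons size_fps_inv_prefix ltnn eqxx mulrAC mulVr // mul1r.
under eq_bigr => k _.
  rewrite -/(fps_inv_prefix f k.+1) mulrC -(@fps_inv_prefixE _ n) //; over.
by rewrite addrC subrK; case: eqP.
Qed.

Lemma fps_unitPl f g : g * f = 1 -> fps_unit f.
Proof.
move=> /(congr1 (fun h : fps R => h 0%N)).
rewrite -[LHS]/(\sum_(k < 1) _) big_ord1 subnn -[RHS]/(1 : R) => gf1.
by apply/unitrP; exists (g 0%N); split=> //; rewrite mulrC.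
Qed.

Lemma fps_inv_out : {in [predC fps_unit], fps_inv =1 id}.
Proof. by move=> f /negPf nUf; rewrite /fps_inv ifF. Qed.

HB.instance Definition _ := GRing.ComNzRing_hasMulInverse.Build (fps R)
  fps_mulV fps_unitPl fps_inv_out.

End FpsUnit.

Section F3.
Variable R : comNzRingType.
Implicit Types f g : fps R.

Let agree n f g := forall i, (i < n)%N -> f i = g i.

Let agree_mul n f g f' g' : agree n f f' -> agree n g g' ->
  agree n (f * g) (f' * g').
Proof.
move=> ff gg i lt_in; apply: eq_bigr => k _; rewrite ff ?gg //.
  exact: leq_ltn_trans (leq_subr _ _) lt_in.
exact: leq_trans (ltn_ord k) lt_in.
Qed.

Let agree_mulX n f g : agree n f g -> agree n.+1 (fpsX * f) (fpsX * g).
Proof.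
move=> fg i le_in; rewrite -![LHS]/(\sum_(k < i.+1) _).
rewrite -[RHS]/(\sum_(k < i.+1) _) !big_ord_recl /= !mul0r; congr (_ + _).
apply: eq_bigr => k _; congr (_ * _); apply: fg; rewrite /= /bump /= add1n.
have := ltn_ord k; case: i le_in k => [|i] le_in k //= _.
by rewrite subSS; apply: leq_ltn_trans (leq_subr _ _) _; rewrite -ltnS.
Qed.

Let agreeW m n f g : (m <= n)%N -> agree n f g -> agree m f g.
Proof. by move=> mn fg i im; apply: fg; apply: leq_trans mn. Qed.

Lemma f3_exists_unique (a b : R) :
  exists! f : fps R, f = 1 + fpsC a * fpsX * f + fpsC b * fpsX ^+ 3 * f ^+ 2.
Proof.
pose F f := 1 + fpsC a * fpsX * f + fpsC b * fpsX ^+ 3 * f ^+ 2.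
have Fcontr n f g : agree n f g -> agree n.+1 (F f) (F g).
  move=> fg i le_in; rewrite /F (exprS fpsX 2) -!mulrA.
  congr (_ + _ + _).
    by apply: (@agree_mul n.+1) le_in => //; apply: agree_mulX.
  apply: (@agree_mul n.+1) le_in => //; apply: agree_mulX.
  apply: agree_mul => //; apply: agree_mul => //; exact: agree_mul.
pose s n := iter n F 0.
have sS n : agree n (s n) (s n.+1).
  by elim: n => [|n IH] //; apply: Fcontr.
have sD n m : agree n (s n) (s (m + n)%N).
  elim: m => [|m IH] // i lt_in; rewrite IH // sS //.
  exact: leq_trans lt_in (leq_addl _ _).
pose f := Fps (fun n => s n.+1 n).
have fs n : agree n f (s n).
  by move=> i lt_in; rewrite -[LHS]/(s i.+1 i) (sD i.+1 (n - i.+1)%N) // subnK.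
exists f; split.
  apply: fpsP => n; have /(_ n (ltnSn n)) := Fcontr _ _ _ (fs n).
  by rewrite -/(F f) => ->.
move=> g gE; apply: fpsP => n.
have: agree n.+1 (s n.+1) g.
  elim: n.+1 => [|m IH] // i im; rewrite [g]gE; exact: Fcontr im.
exact.
Qed.

End F3.

Definition D2 (R : comNzRingType) (c : nat -> R) (N : nat) : R :=
  \det (\matrix_(i < N, j < N) c (i + j + 2)%N).

(* Main.v *)
Require Import Defs.
From HB Require Import structures.
From mathcomp Require Import all_boot all_order all_algebra.
From mathcomp Require Import boolp reals.
From mathcomp Require Import complex.
From mathcomp Require Import perm ring zify.
Set Implicit Arguments.
Unset Strict Implicit.
Unset Printing Implicit Defensive.
Import GRing.Theory.
Local Open Scope ring_scope.

(* Put [F = f / (1 - t z f)].  Since [f = 1 / (1 - a z - b z^3 f)] and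
   [F = 1 / (1 - (a + t) z - b z^3 f)], in [x = 1 / z] the series [F] is a
   continued fraction with partial denominators
   [x - (a + t), x^2 - a x, x - a, x^2 - a x, x - a, ...].
   Hence the moment functional [L : x^n |-> C n] has monic orthogonal
   polynomials [u_n] of degree [3 n] and [v_n] of degree [3 n + 1], with moment
   series [F w^n] and [b z^2 f F w^n] for [w = b^2 z^3 f^2], but in general none
   of degree [3 n + 2].  The Hankel determinant of [C (i + j + 2)] is that of
   the functionals [P |-> L (x^i P)], [P |-> P 0], [P |-> P' 0] on the monomials.
   Replacing the last monomials by orthogonal polynomials factors it into an
   unshifted Hankel determinant and a determinant of size 2 or 3, which amounts
   to the value at 0 of [v_n ^ 2] or of the Wronskian of two consecutive
   orthogonal polynomials (Christoffel's formula).  As no division occurs, the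
   case [b = 0] is not special. *)

(** * Determinants of linear functionals *)

Section Determinants.
Variable R : comNzRingType.

Lemma det_mx22 (A : 'M[R]_2) : \det A = A 0 0 * A 1 1 - A 0 1 * A 1 0.
Proof.
rewrite (expand_det_row _ 0) !big_ord_recl big_ord0 /cofactor !det_mx11 !mxE.
rewrite addr0 expr0 mul1r expr1 mulN1r mulrN.
by congr (_ * A _ _ - A _ _ * A _ _); apply: val_inj.
Qed.

Lemma det_mx33 (A : 'M[R]_3) :
  \det A = A 0 0 * (A 1 1 * A 2 2 - A 1 2 * A 2 1)
    - A 0 1 * (A 1 0 * A 2 2 - A 1 2 * A 2 0)
    + A 0 2 * (A 1 0 * A 2 1 - A 1 1 * A 2 0).
Proof.
rewrite (expand_det_row _ 0) !big_ord_recl big_ord0 /cofactor !det_mx22 !mxE.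
rewrite addr0 addrA expr0 mul1r expr1 mulN1r mulrN expr2 mulrNN mul1r mul1r.
do ![congr (_ + _) | congr (- _) | congr (_ * _)].
all: by congr (A _ _); apply: val_inj.
Qed.

Lemma det_rotate_rows2 n (A : 'M[R]_n) :
  \det (\matrix_(i, j) A (ordS (ordS i)) j) = \det A.
Proof.
pose s := perm (@ordS_inj n).
transitivity (\det (row_perm s (row_perm s A))).
  by congr (\det _); apply/matrixP => i j; rewrite !mxE !permE.
by rewrite !row_permE !det_mulmx !det_perm mulrA -expr2 sqrr_sign mul1r.
Qed.

End Determinants.

Section Polynomials.
Variable R : comNzRingType.
Implicit Types P Q : {poly R}.

Lemma coefXsubCM k P n :
  (('X - k%:P) * P)`_n = (if n is m.+1 then P`_m else 0) - k * P`_n.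
Proof. by rewrite mulrBl coefB coefXM mul_polyC coefZ; case: n. Qed.

Definition monic_of_degree n P : Prop := P \is monic /\ size P = n.+1.

Lemma monic_of_degree_coef n P : monic_of_degree n P -> P`_n = 1.
Proof. by case=> /monicP <- sP; rewrite lead_coefE sP. Qed.

Lemma monic_of_degreeXn n : monic_of_degree n 'X^n.
Proof. by split; [apply: monicXn | apply: size_polyXn]. Qed.

Lemma monic_of_degreeX : monic_of_degree 1 'X.
Proof. exact: (monic_of_degreeXn 1). Qed.

Lemma monic_of_degreeXsubC c : monic_of_degree 1 ('X - c%:P).
Proof. by split; [apply: monicXsubC | apply: size_XsubC]. Qed.

Lemma monic_of_degreeM m n P Q : monic_of_degree m P -> monic_of_degree n Q ->
  monic_of_degree (m + n) (P * Q).
Proof.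
move=> [Pm sP] [Qm sQ]; split; first by rewrite monicMl.
by rewrite size_monicM ?monic_neq0 // sP sQ addSn addnS.
Qed.

Lemma monic_of_degreeB m n P Q : monic_of_degree n P -> (m < n)%N ->
  (size Q <= m.+1)%N -> monic_of_degree n (P - Q).
Proof.
move=> [Pm sP] mn sQ.
have QP : (size (- Q) < size P)%N by rewrite size_polyN sP ltnS (leq_trans sQ).
by split; [rewrite monicE lead_coefDl // -monicE | rewrite size_polyDl].
Qed.

End Polynomials.

Section Functionals.
Variable R : comNzRingType.
Implicit Types (phi : nat -> {scalar {poly R}}) (p : nat -> {poly R}).

Definition functional_mx phi p n : 'M[R]_n := \matrix_(i, j) phi i (p j).

Lemma det_functional_mx_monic phi p n :
  (forall j, (j < n)%N -> monic_of_degree j (p j)) ->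
  \det (functional_mx phi p n) = \det (functional_mx phi (fun j => 'X^j) n).
Proof.
move=> p_monic; pose U : 'M[R]_n := \matrix_(l, j) (p j)`_l.
have detU : \det U = 1.
  rewrite -det_tr det_trig; first apply: big1 => i _.
    by rewrite !mxE (monic_of_degree_coef (p_monic _ _)).
  apply/is_trig_mxP => i j ij; rewrite !mxE nth_default //.
  by have [_ ->] := p_monic _ (ltn_ord i).
rewrite -[RHS]mulr1 -detU -det_mulmx; congr (\det _).
apply/matrixP => i j; rewrite !mxE.
have [_ sp] := p_monic _ (ltn_ord j).
rewrite -{1}(coefK (p j)) poly_def linear_sum /=.
rewrite sp (big_ord_widen n (fun l => phi i ((p j)`_l *: 'X^l))) //.
rewrite big_mkcond; apply: eq_bigr => l _; rewrite !mxE linearZ /= mulrC.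
by case: ltnP => // jl; rewrite nth_default ?mulr0 // sp.
Qed.

Lemma det_functional_mx_orthogonal phi p m k :
    (forall j, (j < k)%N -> monic_of_degree (m + j) (p j)) ->
    (forall i j, (i < m)%N -> (j < k)%N -> phi i (p j) = 0) ->
  \det (functional_mx phi (fun j => 'X^j) (m + k)) =
    \det (functional_mx phi (fun j => 'X^j) m)
    * \det (functional_mx (fun i => phi (m + i)%N) p k).
Proof.
move=> p_monic p_orth.
pose q j := if (j < m)%N then 'X^j else p (j - m)%N.
have q_low j : (j < m)%N -> q j = 'X^j by rewrite /q => ->.
have q_high j : q (m + j)%N = p j by rewrite /q ltnNge leq_addr addKn.
rewrite -(@det_functional_mx_monic _ q); last first.
  move=> j jmk; rewrite /q; case: ltnP => [_|mj].
    exact: monic_of_degreeXn.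
  by rewrite -{1}(subnKC mj); apply: p_monic; rewrite ltn_subLR.
set Q := functional_mx phi q _.
rewrite -(det_lblock _ (dlsubmx Q)) -{1}[Q]submxK.
congr (\det (block_mx _ _ _ _)).
- by apply/matrixP => i j; rewrite !mxE /= q_low.
- by apply/matrixP => i j; rewrite !mxE /= q_high p_orth.
- by apply/matrixP => i j; rewrite !mxE /= q_high.
Qed.

End Functionals.

(** * Formal power series *)

Section FormalPowerSeries.
Variable R : comNzRingType.
Implicit Types (g h : fps R) (k : R).

Fact fpsC_is_zmod_morphism : zmod_morphism (@fpsC R).
Proof. by move=> x y; apply: fpsP => -[|n] //=; rewrite subr0. Qed.

Lemma coef_fpsCM k g n : (fpsC k * g) n = k * g n.
Proof.
rewrite -[LHS]/(\sum_(i < n.+1) _) big_ord_recl /= subn0.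
by rewrite big1 ?addr0 // => i _; rewrite mul0r.
Qed.

Fact fpsC_is_monoid_morphism : monoid_morphism (@fpsC R).
Proof.
split=> // x y; apply: fpsP => n; rewrite coef_fpsCM /=.
by case: n => [|n] //=; rewrite mulr0.
Qed.

HB.instance Definition _ :=
  GRing.isZmodMorphism.Build R (fps R) (@fpsC R) fpsC_is_zmod_morphism.
HB.instance Definition _ :=
  GRing.isMonoidMorphism.Build R (fps R) (@fpsC R) fpsC_is_monoid_morphism.

Definition fps_coef0 g : R := g 0%N.

Fact fps_coef0_is_zmod_morphism : zmod_morphism fps_coef0.
Proof. by []. Qed.

Fact fps_coef0_is_monoid_morphism : monoid_morphism fps_coef0.
Proof. by split=> // g h; rewrite -[LHS]/(\sum_(i < 1) _) big_ord1. Qed.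

HB.instance Definition _ :=
  GRing.isZmodMorphism.Build (fps R) R fps_coef0 fps_coef0_is_zmod_morphism.
HB.instance Definition _ :=
  GRing.isMonoidMorphism.Build (fps R) R fps_coef0 fps_coef0_is_monoid_morphism.

Lemma coef_fpsXM g n : (fpsX * g) n = if n is m.+1 then g m else 0.
Proof.
rewrite -[LHS]/(\sum_(i < n.+1) _) big_ord_recl /= mul0r add0r.
case: n => [|n]; first by rewrite big_ord0.
rewrite big_ord_recl /= subSS subn0 mul1r big1 ?addr0 // => i _.
by rewrite mul0r.
Qed.

Lemma coef_fpsXnM g d n :
  (fpsX ^+ d * g) n = if (n < d)%N then 0 else g (n - d)%N.
Proof.
elim: d n => [|d IH] n; first by rewrite expr0 mul1r subn0.
by rewrite exprS -mulrA coef_fpsXM; case: n => [|n] //; rewrite IH.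
Qed.

Lemma fpsX_lreg : GRing.lreg (@fpsX R).
Proof.
move=> g h gh; apply: fpsP => n.
by have := coef_fpsXM g n.+1; rewrite gh coef_fpsXM.
Qed.

End FormalPowerSeries.

(** * Moments and Hankel determinants *)

Section Moments.
Variables (R : comNzRingType) (c : nat -> R).
Implicit Types P Q : {poly R}.

(* The functional [P |-> L (x^m P)], where [L (x^i) = c i]. *)
Definition moment m P : R := \sum_(i < size P) P`_i * c (m + i)%N.

Lemma moment_wide n m P : (size P <= n)%N ->
  moment m P = \sum_(i < n) P`_i * c (m + i)%N.
Proof.
move=> sPn; rewrite /moment (big_ord_widen n (fun i => P`_i * c (m + i)%N)) //.
rewrite big_mkcond; apply: eq_bigr => i _; case: ltnP => // sPi.
by rewrite nth_default ?mul0r.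
Qed.

Fact moment_is_scalar m : scalar (moment m).
Proof.
move=> k P Q; pose n := maxn (size (k *: P + Q)) (maxn (size P) (size Q)).
rewrite !(@moment_wide n) ?leq_max ?leqnn ?orbT // mulr_sumr -big_split.
by apply: eq_bigr => i _; rewrite coefD coefZ mulrDl mulrA.
Qed.

HB.instance Definition _ m :=
  GRing.isLinear.Build R {poly R} R *%R (moment m) (moment_is_scalar m).

Lemma momentXM m P : moment m ('X * P) = moment m.+1 P.
Proof.
rewrite (@moment_wide (size P).+1).
  rewrite big_ord_recl coefXM mul0r add0r; apply: eq_bigr => i _.
  by rewrite coefXM /= /bump add1n addnS.
by rewrite (leq_trans (size_polyMleq _ _)) // size_polyX.
Qed.

Lemma moment1 m : moment m 1 = c m.
Proof. by rewrite /moment size_poly1 big_ord1 coef1 mul1r addn0. Qed.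

Lemma momentXn m n : moment m 'X^n = c (m + n)%N.
Proof.
elim: n m => [|n IH] m; first by rewrite expr0 moment1 addn0.
by rewrite exprS momentXM IH addnS.
Qed.

Definition hankel n : 'M[R]_n := \matrix_(i, j) c (i + j)%N.

Lemma hankelE n : hankel n = functional_mx moment (fun j => 'X^j) n.
Proof. by apply/matrixP => i j; rewrite !mxE /= momentXn. Qed.

Definition orthogonal_below n P : Prop :=
  forall m, (m < n)%N -> moment m P = 0.

Lemma orthogonal_belowW m n P :
  (m <= n)%N -> orthogonal_below n P -> orthogonal_below m P.
Proof. by move=> mn oP i im; apply/oP/(leq_trans im). Qed.

Lemma orthogonal_belowXM n P :
  orthogonal_below n.+1 P -> orthogonal_below n ('X * P).
Proof. by move=> oP i im; rewrite momentXM oP. Qed.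

Lemma det_hankelD m k (p : nat -> {poly R}) :
    (forall j, (j < k)%N -> monic_of_degree (m + j) (p j)) ->
    (forall j, (j < k)%N -> orthogonal_below m (p j)) ->
  \det (hankel (m + k)) =
    \det (hankel m) * \det (functional_mx (fun i => moment (m + i)) p k).
Proof.
move=> p_monic p_orth; rewrite !hankelE.
rewrite (@det_functional_mx_orthogonal _ moment p) // => i j im jk.
exact: p_orth.
Qed.

Lemma det_hankelS n P : monic_of_degree n P -> orthogonal_below n P ->
  \det (hankel n.+1) = \det (hankel n) * moment n P.
Proof.
move=> P_monic P_orth; rewrite -addn1 (@det_hankelD _ _ (fun=> P)) //.
  by rewrite det_mx11 mxE addn0.
by case=> // _; rewrite addn0.
Qed.

Lemma det_hankelSS n P : monic_of_degree n P -> orthogonal_below n.+1 P ->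
  \det (hankel n.+2) = - (\det (hankel n) * moment n.+1 P ^+ 2).
Proof.
move=> P_monic P_orth.
have XP_monic : monic_of_degree n.+1 ('X * P).
  by rewrite -add1n; apply/monic_of_degreeM/P_monic/monic_of_degreeX.
rewrite -addn2 (@det_hankelD _ _ (nth 0 [:: P; 'X * P])).
- rewrite det_mx22 !mxE /= addn0 !momentXM addn1 P_orth // mul0r add0r.
  by rewrite mulrN expr2.
- by move=> [|[|]] // _ /=; rewrite ?addn0 ?addn1.
- move=> [|[|]] // _ /=; first exact: orthogonal_belowW P_orth.
  exact: orthogonal_belowXM.
Qed.

Definition bordered_functional n i : {scalar {poly R}} :=
  if (i < n)%N then moment i : {scalar {poly R}} else coefp (i - n).

Lemma D2_bordered n : D2 c n =
  \det (functional_mx (bordered_functional n) (fun j => 'X^j) n.+2).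
Proof.
pose B : 'M[R]_(2 + n) :=
  \matrix_(i, j) if (i < 2)%N then (i == j)%:R else c (i - 2 + j)%N.
have <- : \det B = D2 c n.
  rewrite -[D2 c n]mul1r -(det1 R 2) -(det_lblock _ (dlsubmx B)) -{1}[B]submxK.
  congr (\det (block_mx _ _ _ _)); apply/matrixP => i j; rewrite !mxE /=.
  - by rewrite ltn_ord.
  - by rewrite (leq_trans (ltn_ord i)) // -val_eqE /= ltn_eqF // ltn_addr.
  - by congr (c _); lia.
rewrite -det_rotate_rows2; congr (\det _); apply/matrixP => i j.
rewrite !mxE /bordered_functional.
have [i_lt|i_ge] := ltnP i n.
  by rewrite /= momentXn !modn_small ?subn2 // ltnS // ltnW.
rewrite -[RHS]/('X^j`_(i - n)) coefXn -val_eqE /=.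
have [->|->] : i = n :> nat \/ i = n.+1 :> nat by have := ltn_ord i; lia.
  by rewrite (@modn_small n.+1) // modnn subnn eq_sym.
by rewrite modnn modn_small // subSnn eq_sym.
Qed.

Lemma bordered_functional_moment n i P :
  (i < n)%N -> bordered_functional n i P = moment i P.
Proof. by rewrite /bordered_functional => ->. Qed.

Lemma bordered_functional_coef n k P : bordered_functional n (n + k) P = P`_k.
Proof. by rewrite /bordered_functional ltnNge leq_addr /= addKn. Qed.

Lemma D2_orthogonal m n k (p : nat -> {poly R}) :
    (m <= n)%N -> n.+2 = (m + k)%N ->
    (forall j, (j < k)%N -> monic_of_degree (m + j) (p j)) ->
    (forall j, (j < k)%N -> orthogonal_below m (p j)) ->
  D2 c n = \det (hankel m)
    * \det (functional_mx (fun i => bordered_functional n (m + i)) p k).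
Proof.
move=> mn nE p_monic p_orth; rewrite D2_bordered nE.
have low i P : (i < m)%N -> bordered_functional n i P = moment i P.
  by move=> im; rewrite bordered_functional_moment // (leq_trans im).
rewrite (@det_functional_mx_orthogonal _ _ p) // => [|i j im jk]; last first.
  by rewrite low // p_orth.
congr (_ * _); rewrite hankelE; congr (\det _).
by apply/matrixP => i j; rewrite !mxE low.
Qed.

Definition wronskian0 P Q : R := P`_0 * Q`_1 - Q`_0 * P`_1.

Lemma wronskian0XM P : wronskian0 P ('X * P) = P`_0 ^+ 2.
Proof. by rewrite /wronskian0 !coefXM mul0r subr0. Qed.

Lemma D2_christoffel n P Q :
    monic_of_degree n P -> monic_of_degree n.+1 Q ->
    orthogonal_below n P -> orthogonal_below n Q ->
  D2 c n = \det (hankel n) * wronskian0 P Q.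
Proof.
move=> P_monic Q_monic P_orth Q_orth.
rewrite (@D2_orthogonal n n 2 (nth 0 [:: P; Q])) ?addn2 //.
- by rewrite det_mx22 !mxE !bordered_functional_coef.
- by move=> [|[|]] // _; rewrite ?addn0 ?addn1.
- by move=> [|[|]].
Qed.

(* Christoffel's formula in a degree, [n.+1], without orthogonal polynomial. *)
Lemma D2_christoffel_gap n P Q :
    monic_of_degree n P -> monic_of_degree n.+2 Q ->
    orthogonal_below n.+1 P -> orthogonal_below n.+1 Q ->
  D2 c n.+1 = - (\det (hankel n) * moment n.+1 P * wronskian0 P Q).
Proof.
move=> P_monic Q_monic P_orth Q_orth.
pose p := nth 0 [:: P; 'X * P; Q].
rewrite (@D2_orthogonal n n.+1 3 p) ?addn3 //; last 2 first.
- move=> [|[|[|]]] // _; rewrite ?addn0 ?addn1 ?addn2 //.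
  by rewrite -add1n; apply/monic_of_degreeM/P_monic/monic_of_degreeX.
- move=> [|[|[|]]] // _; last exact: orthogonal_belowW Q_orth.
    exact: orthogonal_belowW P_orth.
  exact: orthogonal_belowXM.
set A := functional_mx _ _ 3.
have A0 j : A 0 j = moment n (p j).
  by rewrite mxE addn0 bordered_functional_moment.
have A1 j : A 1 j = (p j)`_0.
  by rewrite mxE -(bordered_functional_coef n.+1) addSnnS.
have A2 j : A 2 j = (p j)`_1.
  by rewrite mxE -(bordered_functional_coef n.+1) addSnnS.
rewrite det_mx33 !A0 !A1 !A2 /p /= momentXM P_orth // Q_orth // coefXM.
by rewrite /wronskian0; ring.
Qed.

End Moments.

Section MomentSeries.
Variables (R : comNzRingType) (c : nat -> R).
Implicit Types P Q : {poly R}.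

Definition moment_series P : fps R := Fps (moment c ^~ P).

Fact moment_series_is_zmod_morphism : zmod_morphism moment_series.
Proof. by move=> P Q; apply: fpsP => m; apply: linearB. Qed.

HB.instance Definition _ := GRing.isZmodMorphism.Build {poly R} (fps R)
  moment_series moment_series_is_zmod_morphism.

Lemma moment_seriesZ k P : moment_series (k *: P) = fpsC k * moment_series P.
Proof. by apply: fpsP => m; rewrite coef_fpsCM; apply: linearZ. Qed.

Lemma moment_series1 : moment_series 1 = Fps c.
Proof. by apply: fpsP => m; apply: moment1. Qed.

Lemma fpsX_moment_seriesXM P :
  fpsX * moment_series ('X * P) = moment_series P - fpsC (moment c 0 P).
Proof.
apply: fpsP => -[|m]; rewrite coef_fpsXM /= ?subrr //.
by rewrite momentXM subr0.
Qed.

Lemma fpsX_moment_seriesXsubCM k P :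
  fpsX * moment_series (('X - k%:P) * P) =
    (1 - fpsC k * fpsX) * moment_series P - fpsC (moment c 0 P).
Proof.
rewrite mulrBl mul_polyC raddfB /= moment_seriesZ mulrBr fpsX_moment_seriesXM.
by ring.
Qed.

Lemma orthogonal_below_series d g P :
  moment_series P = fpsX ^+ d * g -> orthogonal_below c d P.
Proof.
by move=> Pg m md; rewrite -[LHS]/(moment_series P m) Pg coef_fpsXnM md.
Qed.

Lemma moment_series_lead d g P :
  moment_series P = fpsX ^+ d * g -> moment c d P = fps_coef0 g.
Proof.
by move=> Pg; rewrite -[LHS]/(moment_series P d) Pg coef_fpsXnM ltnn subnn.
Qed.

End MomentSeries.

(** * The orthogonal polynomials *)

Section OrthogonalPolynomials.
Variables (R : comNzRingType) (a b t : R).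

(* The denominators of degrees [3 n] and [3 n + 1] of the convergents of the
   continued fraction of [f / (1 - t z f)] in [x = 1 / z]. *)
Fixpoint opoly_pair n : {poly R} * {poly R} :=
  if n is m.+1 then
    let: (u, v) := opoly_pair m in
    let u' := ('X - a%:P) * ('X * v) - b *: u in
    (u', ('X - a%:P) * u' - b *: v)
  else (1, 'X - (a + t)%:P).

Definition opoly_3n n : {poly R} := (opoly_pair n).1.
Definition opoly_3n1 n : {poly R} := (opoly_pair n).2.

Lemma opoly_3nS n :
  opoly_3n n.+1 = ('X - a%:P) * ('X * opoly_3n1 n) - b *: opoly_3n n.
Proof. by rewrite /opoly_3n /opoly_3n1 /=; case: (opoly_pair n). Qed.

Lemma opoly_3n1S n :
  opoly_3n1 n.+1 = ('X - a%:P) * opoly_3n n.+1 - b *: opoly_3n1 n.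
Proof. by rewrite /opoly_3n /opoly_3n1 /=; case: (opoly_pair n). Qed.

Lemma opoly_monic n :
  monic_of_degree (3 * n) (opoly_3n n) /\
  monic_of_degree (3 * n).+1 (opoly_3n1 n).
Proof.
elim: n => [|n [u_monic v_monic]].
  by split; [apply: (monic_of_degreeXn _ 0) | apply: monic_of_degreeXsubC].
have u'_monic : monic_of_degree (3 * n.+1) (opoly_3n n.+1).
  rewrite opoly_3nS; apply: (@monic_of_degreeB _ (3 * n)); last 2 first.
  - by lia.
  - by rewrite (leq_trans (size_scale_leq _ _)) // u_monic.2.
  have -> : (3 * n.+1 = 1 + (1 + (3 * n).+1))%N by lia.
  apply: monic_of_degreeM; first exact: monic_of_degreeXsubC.
  exact/monic_of_degreeM/v_monic/monic_of_degreeX.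
split=> //; rewrite opoly_3n1S; apply: (@monic_of_degreeB _ (3 * n).+1).
- rewrite -add1n; apply: monic_of_degreeM u'_monic.
  exact: monic_of_degreeXsubC.
- by lia.
by rewrite (leq_trans (size_scale_leq _ _)) // v_monic.2.
Qed.

Lemma opoly_3n_coef0 n : (opoly_3n n)`_0 = (- b) ^+ n.
Proof.
elim: n => [|n IH]; first by rewrite coef1.
by rewrite opoly_3nS coefB coefZ coefXsubCM coefXM IH exprS /=; ring.
Qed.

Let tau n : R := t + n.+1%:R * a.

Lemma opoly_3n1_coef0 n : (opoly_3n1 n)`_0 = - ((- b) ^+ n * tau n).
Proof.
elim: n => [|n IH]; first by rewrite coefB coefX coefC /tau /=; ring.
rewrite opoly_3n1S coefB coefZ coefXsubCM IH opoly_3n_coef0 exprS /tau.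
by rewrite -[n.+2%:R]natr1; ring.
Qed.

Lemma sqr_opoly_3n_coef0 n : (opoly_3n n)`_0 ^+ 2 = b ^+ (2 * n).
Proof. by rewrite opoly_3n_coef0 -exprM mulnC exprM sqrrN -exprM. Qed.

Lemma sqr_opoly_3n1_coef0 n :
  (opoly_3n1 n)`_0 ^+ 2 = b ^+ (2 * n) * tau n ^+ 2.
Proof.
by rewrite opoly_3n1_coef0 sqrrN exprMn -opoly_3n_coef0 sqr_opoly_3n_coef0.
Qed.

Lemma wronskian0_opoly_3nS_rec n :
  wronskian0 (opoly_3n n.+1) (opoly_3n1 n.+1) =
    b ^+ (2 * n.+1) + b * wronskian0 (opoly_3n1 n) (opoly_3n n.+1).
Proof.
rewrite -sqr_opoly_3n_coef0 /wronskian0 opoly_3n1S.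
by rewrite !coefB !coefZ !coefXsubCM; ring.
Qed.

Lemma wronskian0_opoly_3n1_rec n :
  wronskian0 (opoly_3n1 n) (opoly_3n n.+1) =
    b * wronskian0 (opoly_3n n) (opoly_3n1 n) - a * (b ^+ (2 * n) * tau n ^+ 2).
Proof.
rewrite -sqr_opoly_3n1_coef0 /wronskian0 opoly_3nS.
by rewrite !coefB !coefZ !coefXsubCM !coefXM /=; ring.
Qed.

Lemma wronskian0_opoly_3n1 n :
  wronskian0 (opoly_3n1 n) (opoly_3n n.+1) =
    b ^+ (2 * n) * (n.+1%:R * b - a * \sum_(0 <= i < n.+1) tau i ^+ 2).
Proof.
elim: n => [|n IH]; rewrite wronskian0_opoly_3n1_rec.
  rewrite big_nat1 /wronskian0 /opoly_3n /opoly_3n1 /=.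
  by rewrite !coefB !coefX !coefC /tau /=; ring.
rewrite wronskian0_opoly_3nS_rec big_nat_recr //= IH -[n.+2%:R]natr1.
by rewrite mulnS !exprD; ring.
Qed.

Lemma wronskian0_opoly_3nS n :
  wronskian0 (opoly_3n n.+1) (opoly_3n1 n.+1) =
    b ^+ (2 * n).+1 * (n.+2%:R * b - a * \sum_(0 <= i < n.+1) tau i ^+ 2).
Proof.
rewrite wronskian0_opoly_3nS_rec wronskian0_opoly_3n1 -[n.+2%:R]natr1 mulnS.
by rewrite !exprS; ring.
Qed.

End OrthogonalPolynomials.

Lemma sum_sqr_arithmetic (R : comNzRingType) (a t : R) n :
  a * (\sum_(0 <= i < n) (t + i.+1%:R * a) ^+ 2) =
    a ^+ 3 * (\sum_(0 <= i < n.+1) i%:R ^+ 2)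
    + n%:R * a * t * (t + n.+1%:R * a).
Proof.
elim: n => [|n IH]; first by rewrite big_nil big_nat1; ring.
rewrite big_nat_recr // big_nat_recr //= !mulrDr IH.
by rewrite -[n.+2%:R]natr1 -[n.+1%:R]natr1; ring.
Qed.

(** * Orthogonality and the shifted determinants *)

Section ShiftedDeterminants.
Variables (R : comNzRingType) (a b t : R) (f : fps R) (c : nat -> R).
Let F : fps R := Fps c.
Hypothesis f_eq : f = 1 + fpsC a * fpsX * f + fpsC b * fpsX ^+ 3 * f ^+ 2.
Hypothesis F_eq : F * (1 - fpsC t * fpsX * f) = f.

Let u := opoly_3n a b t.
Let v := opoly_3n1 a b t.

Let coef0_f : fps_coef0 f = 1.
Proof. by rewrite f_eq !rmorphD !rmorphM /=; ring. Qed.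

Let c0 : c 0%N = 1.
Proof.
have := congr1 (@fps_coef0 R) F_eq.
by rewrite rmorphM rmorphB !rmorphM /= coef0_f => <-; ring.
Qed.

Let f_quadratic : (1 - fpsC a * fpsX) * f = 1 + fpsC b * fpsX ^+ 3 * f ^+ 2.
Proof. by rewrite mulrBl mul1r {1}f_eq; ring. Qed.

Let F_linear : (1 - fpsC (a + t) * fpsX) * F = 1 + fpsC b * fpsX ^+ 3 * f * F.
Proof.
set g := 1 - fpsC a * fpsX - fpsC b * fpsX ^+ 3 * f.
have fg : f * g = 1.
  rewrite (_ : f * g = (1 - fpsC a * fpsX) * f - fpsC b * fpsX ^+ 3 * f ^+ 2).
    by rewrite f_quadratic addrK.
  by rewrite /g; ring.
have Fg : F * (g - fpsC t * fpsX) = 1.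
  transitivity (F * (g - fpsC t * fpsX * (f * g))); first by rewrite fg mulr1.
  by rewrite -[RHS]fg -[in RHS]F_eq; ring.
transitivity (F * (g - fpsC t * fpsX) + fpsC b * fpsX ^+ 3 * f * F).
  by rewrite rmorphD /g /=; ring.
by rewrite Fg.
Qed.

Let w : fps R := fpsC b ^+ 2 * fpsX ^+ 3 * f ^+ 2.

Lemma moment_series_opoly_3nS n T :
    moment_series c (u n) = T ->
    moment_series c (v n) = fpsC b * fpsX ^+ 2 * f * T ->
  moment_series c (u n.+1) = w * T.
Proof.
move=> Mu Mv; have orth_v : orthogonal_below c 2 (v n).
  by apply: (@orthogonal_below_series _ _ _ (fpsC b * f * T)); rewrite Mv; ring.
do 2!apply: fpsX_lreg; rewrite /u opoly_3nS raddfB /= moment_seriesZ.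
rewrite mulrBr fpsX_moment_seriesXsubCM momentXM orth_v // rmorph0 subr0.
rewrite mulrBr mulrCA fpsX_moment_seriesXM orth_v // rmorph0 subr0 Mu Mv.
transitivity (fpsC b * fpsX ^+ 2 * T * ((1 - fpsC a * fpsX) * f - 1)).
  by ring.
by rewrite f_quadratic /w; ring.
Qed.

Lemma moment_series_opoly_3n1S n T :
    moment_series c (u n.+1) = w * T ->
    moment_series c (v n) = fpsC b * fpsX ^+ 2 * f * T ->
  moment_series c (v n.+1) = fpsC b * fpsX ^+ 2 * f * (w * T).
Proof.
move=> Mu Mv; have orth_u : orthogonal_below c 3 (u n.+1).
  apply: (@orthogonal_below_series _ _ _ (fpsC b ^+ 2 * f ^+ 2 * T)).
  by rewrite Mu /w; ring.
apply: fpsX_lreg; rewrite /v opoly_3n1S raddfB /= moment_seriesZ.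
rewrite mulrBr fpsX_moment_seriesXsubCM orth_u // rmorph0 subr0 Mu Mv.
transitivity (fpsC b ^+ 2 * fpsX ^+ 3 * f * T * ((1 - fpsC a * fpsX) * f - 1)).
  by rewrite /w; ring.
by rewrite f_quadratic /w; ring.
Qed.

Lemma moment_series_opoly n :
  moment_series c (u n) = F * w ^+ n /\
  moment_series c (v n) = fpsC b * fpsX ^+ 2 * f * (F * w ^+ n).
Proof.
elim: n => [|n [Mu Mv]].
  have Mu : moment_series c (u 0) = F by rewrite moment_series1.
  rewrite expr0 mulr1; split=> //; apply: fpsX_lreg.
  have -> : v 0 = ('X - (a + t)%:P) * u 0 by rewrite mulr1.
  rewrite fpsX_moment_seriesXsubCM Mu F_linear moment1 c0.
  by rewrite rmorph1; ring.
rewrite exprS mulrCA; have Mu' := moment_series_opoly_3nS Mu Mv.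
by split=> //; apply: moment_series_opoly_3n1S.
Qed.

Lemma opoly_3n_series n :
  moment_series c (u n) =
    fpsX ^+ (3 * n) * (fpsC (b ^+ (2 * n)) * (F * f ^+ (2 * n))).
Proof.
by rewrite (moment_series_opoly n).1 /w rmorphXn /= !exprM !exprMn; ring.
Qed.

Lemma opoly_3n1_series n :
  moment_series c (v n) =
    fpsX ^+ (3 * n).+2 * (fpsC (b ^+ (2 * n).+1) * (F * f ^+ (2 * n).+1)).
Proof.
rewrite (moment_series_opoly n).2 /w rmorphXn /= (exprS _ (3 * n).+1).
by rewrite !(exprS _ (_ * _)) !exprM !exprMn; ring.
Qed.

Lemma opoly_3n_orthogonal n : orthogonal_below c (3 * n) (u n).
Proof. exact: orthogonal_below_series (opoly_3n_series n). Qed.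

Lemma opoly_3n1_orthogonal n : orthogonal_below c (3 * n).+2 (v n).
Proof. exact: orthogonal_below_series (opoly_3n1_series n). Qed.

Lemma moment_opoly_3n n : moment c (3 * n) (u n) = b ^+ (2 * n).
Proof.
rewrite (moment_series_lead (opoly_3n_series n)) !rmorphM /= rmorphXn /=.
by rewrite coef0_f c0 expr1n !mulr1.
Qed.

Lemma moment_opoly_3n1 n : moment c (3 * n).+2 (v n) = b ^+ (2 * n).+1.
Proof.
rewrite (moment_series_lead (opoly_3n1_series n)) !rmorphM /= rmorphXn /=.
by rewrite coef0_f c0 expr1n !mulr1.
Qed.

Lemma det_hankel_3n1_3n n :
  \det (hankel c (3 * n).+1) = \det (hankel c (3 * n)) * b ^+ (2 * n).
Proof.
rewrite -moment_opoly_3n; apply: det_hankelS; last exact: opoly_3n_orthogonal.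
exact: (opoly_monic a b t n).1.
Qed.

Lemma det_hankel_3n n :
  \det (hankel c (3 * n)) = (-1) ^+ n * b ^+ (3 * n ^ 2 - n).
Proof.
elim: n => [|n IH]; first by rewrite det_mx00 mul1r.
have [_ v_monic] := opoly_monic a b t n.
have -> : (3 * n.+1 = (3 * n).+3)%N by lia.
rewrite (det_hankelSS v_monic (@opoly_3n1_orthogonal n)) moment_opoly_3n1.
rewrite det_hankel_3n1_3n IH -exprM -!mulrA -!exprD exprS mulN1r mulNr.
by congr (- (_ * b ^+ _)); nia.
Qed.

Lemma det_hankel_3n1 n :
  \det (hankel c (3 * n).+1) = (-1) ^+ n * b ^+ (3 * n ^ 2 + n).
Proof.
rewrite det_hankel_3n1_3n det_hankel_3n -mulrA -exprD.
by congr (_ * b ^+ _); nia.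
Qed.

Lemma D2_3n n : D2 c (3 * n) = \det (hankel c (3 * n)) * wronskian0 (u n) (v n).
Proof.
have [u_monic v_monic] := opoly_monic a b t n.
apply: D2_christoffel => //; first exact: opoly_3n_orthogonal.
by apply: orthogonal_belowW (@opoly_3n1_orthogonal n); lia.
Qed.

Lemma D2_3nS n : D2 c (3 * n.+1) =
  (-1) ^+ n * b ^+ (3 * n ^ 2 + 7 * n + 3)
  * (a * (\sum_(0 <= i < n.+1) (t + i.+1%:R * a) ^+ 2) - n.+2%:R * b).
Proof.
rewrite D2_3n det_hankel_3n wronskian0_opoly_3nS.
set d := (3 * n.+1 ^ 2 - n.+1)%N; set S := a * \sum_(_ <= _ < _) _.
have -> : (3 * n ^ 2 + 7 * n + 3 = d + (2 * n).+1)%N by rewrite /d; nia.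
by rewrite exprD exprS; ring.
Qed.

Lemma D2_3n1 n : D2 c (3 * n).+1 =
  (-1) ^+ n * (t + n.+1%:R * a) ^+ 2 * b ^+ (3 * n ^ 2 + 3 * n).
Proof.
have [_ v_monic] := opoly_monic a b t n.
have Xv_monic := monic_of_degreeM (monic_of_degreeX R) v_monic.
have v_orth := @opoly_3n1_orthogonal n.
rewrite (D2_christoffel v_monic Xv_monic).
- rewrite det_hankel_3n1 wronskian0XM sqr_opoly_3n1_coef0.
  have -> : (3 * n ^ 2 + 3 * n = (3 * n ^ 2 + n) + 2 * n)%N by lia.
  by rewrite [in RHS]exprD [RHS]mulrAC -!mulrA.
- exact: orthogonal_belowW v_orth.
- exact: orthogonal_belowXM.
Qed.

Lemma D2_3n2 n : D2 c (3 * n).+2 =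
  (-1) ^+ n * b ^+ (3 * n ^ 2 + 5 * n + 1)
  * (a * (\sum_(0 <= i < n.+1) (t + i.+1%:R * a) ^+ 2) - n.+1%:R * b).
Proof.
have [_ v_monic] := opoly_monic a b t n.
have [u_monic _] := opoly_monic a b t n.+1; rewrite mulnS in u_monic.
rewrite (D2_christoffel_gap v_monic u_monic (@opoly_3n1_orthogonal n)).
- rewrite det_hankel_3n1 moment_opoly_3n1 wronskian0_opoly_3n1.
  set d := (3 * n ^ 2 + n)%N; set S := a * \sum_(_ <= _ < _) _.
  have -> : (3 * n ^ 2 + 5 * n + 1 = d + (2 * n).+1 + 2 * n)%N.
    by rewrite /d; lia.
  by rewrite !exprD; ring.
- by apply: orthogonal_belowW (@opoly_3n_orthogonal n.+1); rewrite mulnS.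
Qed.

End ShiftedDeterminants.

Theorem theorem6p5 (R : realType) (a b t : R[i])
    (f : fps R[i])
    (hf : f = 1 + fpsC a * fpsX * f + fpsC b * fpsX ^+ 3 * f ^+ 2)
    (C : nat -> R[i])
    (hC : Fps C = f / (1 - fpsC t * fpsX * f)) :
  [/\ forall n : nat, (b != 0) || (0 < n)%N ->
        D2 C (3 * n)%N =
          (-1) ^+ n.+1 * b ^ (3 * n%:Z ^+ 2 + n%:Z - 1)
          * (a ^+ 3 * (\sum_(0 <= i < n.+1) i%:R ^+ 2) - n.+1%:R * b
             + n%:R * a * t * (t + n.+1%:R * a)),
      D2 C 0%N = 1,
      forall n : nat,
        D2 C (3 * n + 1)%N =
          (-1) ^+ n * (t + n.+1%:R * a) ^+ 2 * b ^+ (3 * n ^ 2 + 3 * n)%N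
    & forall n : nat, (1 <= n)%N ->
        D2 C (3 * n - 1)%N =
          (-1) ^+ (n - 1)%N * b ^+ (3 * n ^ 2 - n - 1)%N
          * (a ^+ 3 * (\sum_(0 <= i < n.+1) i%:R ^+ 2) - n%:R * b
             + n%:R * a * t * (t + n.+1%:R * a))].
Proof.
have hF : Fps C * (1 - fpsC t * fpsX * f) = f.
  rewrite hC divrK // -[X in is_true X]/(fps_coef0 _ \is a GRing.unit).
  by rewrite rmorphB !rmorphM /= mulr0 mul0r subr0 unitr1.
have sumE n k : a ^+ 3 * (\sum_(0 <= i < n.+1) i%:R ^+ 2) - k%:R * b
      + n%:R * a * t * (t + n.+1%:R * a)
    = a * (\sum_(0 <= i < n) (t + i.+1%:R * a) ^+ 2) - k%:R * b.
  by rewrite sum_sqr_arithmetic addrAC.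
have D2_0 : D2 C 0 = 1 by apply: det_mx00.
split=> // [[|n]|n|[|n]] //.
- rewrite orbF muln0 D2_0 sumE big_nil => b_neq0.
  by rewrite expr1 -[b ^ _]/(b^-1); field.
- rewrite (D2_3nS hf hF) sumE !(exprS (-1)) !mulN1r opprK => _.
  have -> : 3 * n.+1%:Z ^+ 2 + n.+1%:Z - 1 = (3 * n ^ 2 + 7 * n + 3)%N by lia.
  by rewrite -exprnP.
- by rewrite addn1 (D2_3n1 hf hF).
rewrite sumE => _; have -> : (3 * n.+1 - 1 = (3 * n).+2)%N by lia.
by rewrite (D2_3n2 hf hF); congr (_ ^+ _ * _ ^+ _ * _); lia.
Qed.
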